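(* Let $p$ be a prime number with $p \equiv 1 \pmod 4$. Then $P(\mathcal{O}_{K_{p^\infty}^+}) = \infty$.
   Context: For $N \in \mathbb{N}$ let $\zeta_N = e^{2\pi i/N}$ and $K_N^+ = \mathbb{Q}(\zeta_N + \zeta_N^{-1})$, the maximal real subfield of the $N$-th cyclotomic field. Let $K_{p^\infty}^+ = \bigcup_{n \in \mathbb{N}} K_{p^n}^+$, and $\mathcal{O}_{K_{p^\infty}^+}$ its ring of integers (integral closure of $\mathbb{Z}$). For a commutative ring $R$ and $n \in \mathbb{N}$, let $\Sigma^n R^2 = \{x_1^2 + \cdots + x_n^2 \mid x_i \in R\}$; the Pythagoras number is $P(R) = \inf\{n \in \mathbb{N} \mid \Sigma^n R^2 = \Sigma^{n+1} R^2\} \in \mathbb{N} \cup \{\infty\}$. *)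

(* Defs.v *)
From HB Require Import structures.
From mathcomp Require Import all_boot all_order all_algebra all_field.
From mathcomp Require Import ring lra zify.
From mathcomp Require Import boolp classical_sets.

Set Implicit Arguments.
Unset Strict Implicit.
Unset Printing Implicit Defensive.

Import Order.TTheory GRing.Theory Num.Theory.
Local Open Scope classical_set_scope.
Local Open Scope ring_scope.

Definition sums_of_squares (R : comPzRingType) (n : nat) : set R :=
  [set x | exists y : 'I_n -> R, x = \sum_(i < n) y i ^+ 2].

Arguments sums_of_squares R n : clear implicits.

(* An infimum in N \cup {oo}; [None] stands for oo, the infimum of the empty set. *)
Definition Pythagoras_number (R : comPzRingType) : option nat :=
  if pselect (exists n : nat,
       `[< sums_of_squares R n = sums_of_squares R n.+1 >]) is left exn
  then Some (ex_minn exn) else None.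

(* The number e^(2 i pi / N). For N > 0, N.-root (-1) is the N-th root of -1 of
   least argument in [0, 2 pi), that is e^(i pi / N). *)
Definition zeta (N : nat) : algC := (N.-root (-1)) ^+ 2.

(* The field Q(a). A divring-closed subset of algC is a subfield, and hence
   contains the rationals. *)
Definition Qadjoin (a : algC) : {pred algC} :=
  fun x => `[< forall S : {pred algC},
                 GRing.divring_closed S -> a \in S -> x \in S >].

Definition Kplus (N : nat) : {pred algC} := Qadjoin (zeta N + (zeta N)^-1).

Definition Kplus_pinf (p : nat) : {pred algC} :=
  fun x => `[< exists n : nat, x \in Kplus (p ^ n) >].

(* The integral closure of Z in the field [Kplus_pinf p]; the ring structure on
   it is [O_Kplus_pinf p] below. *)
Definition int_Kplus_pinf (p : nat) : {pred algC} :=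
  fun x => (x \in Kplus_pinf p) && `[< integralOver (intr : int -> algC) x >].

Lemma QadjoinP (a x : algC) :
  reflect (forall S : {pred algC}, GRing.divring_closed S -> a \in S -> x \in S)
          (x \in Qadjoin a).
Proof. exact: asboolP. Qed.

Lemma Qadjoin_divring a : GRing.divring_closed (Qadjoin a).
Proof.
split=> [|x y /QadjoinP Sx /QadjoinP Sy|x y /QadjoinP Sx /QadjoinP Sy];
  by apply/QadjoinP => S cS aS; case: (cS) => S1 SB SV;
     rewrite ?S1 ?SB ?SV ?Sx ?Sy.
Qed.

Lemma mem_Qadjoin a : a \in Qadjoin a.
Proof. exact/QadjoinP. Qed.

Lemma Qadjoin_sub a b : a \in Qadjoin b -> {subset Qadjoin a <= Qadjoin b}.
Proof. by move=> ab x /QadjoinP/(_ _ (Qadjoin_divring b) ab). Qed.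

(* If u = c + i e <> 1 is a point of the upper unit semicircle and v = a + i b a point
   of the unit circle with Re v <= Re u, and neither v u^2 nor v u^-2 has a larger
   real part than v, then v = u or v is the conjugate of u. *)
Lemma circle_aux (R : realFieldType) (a b c e : R) :
  a ^+ 2 + b ^+ 2 = 1 -> c ^+ 2 + e ^+ 2 = 1 -> c != 1 -> a <= c -> 0 <= e ->
  a * (c ^+ 2 - e ^+ 2) - b * (2 * c * e) <= a ->
  a * (c ^+ 2 - e ^+ 2) + b * (2 * c * e) <= a ->
  a = c /\ (b = e \/ b = - e).
Proof.
move=> h1 h2 c1 ac e0 H1 H2.
suff ac' : a = c.
  split=> //; have : b ^+ 2 == e ^+ 2 by apply/eqP; rewrite ac' in h1; lra.
  by rewrite eqf_sqr => /orP[] /eqP; [left | right].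
apply/le_anti; rewrite ac /=.
have [e_eq0|ene] := eqVneq e 0.
  have : c ^+ 2 == 1 ^+ 2 by apply/eqP; rewrite e_eq0 in h2; lra.
  rewrite eqf_sqr (negPf c1) /= => /eqP cE; rewrite cE in ac *; nra.
have ep : 0 < e by rewrite lt_def ene.
have l1 : - (b * c) <= a * e by rewrite -(ler_pM2r ep); nra.
have l2 : b * c <= a * e by rewrite -(ler_pM2r ep); nra.
have a0 : 0 <= a by rewrite -(pmulr_lge0 _ ep); lra.
have l3 : (b * c) ^+ 2 <= (a * e) ^+ 2.
  have : 0 <= (a * e - b * c) * (a * e + b * c) by rewrite mulr_ge0; lra.
  nra.
have : c ^+ 2 <= a ^+ 2 by nra.
by rewrite ler_pXn2r ?nnegrE //; lra.
Qed.

Lemma zeta_prim (N : nat) : (0 < N)%N -> N.-primitive_root (zeta N).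
Proof.
case: N => [//|[|n] _].
  rewrite /zeta root1C sqrrN expr1n.
  have [m mP] := prim_order_exists (ltn0Sn 0) (expr1 (1 : algC)).
  by rewrite dvdn1 => /eqP <-.
set N := n.+2; set u : algC := N.-root (-1); set t := u ^+ 2.
have N0 : (0 < N)%N by [].
have uN : u ^+ N = -1 by rewrite rootCK.
have norm1 (v : algC) : v ^+ N = -1 -> `|v| = 1.
  by move=> vN; apply/eqP; rewrite -(pexpr_eq1 N0) // -normrX vN normrN1.
have Cnorm (v : algC) : v ^+ N = -1 -> 'Re v ^+ 2 + 'Im v ^+ 2 = 1.
  by move=> vN; rewrite -normC2_Re_Im norm1 ?expr1n.
have maxu (v : algC) : v ^+ N = -1 -> 'Re v <= 'Re u.
  move=> vN; have [Iv|Iv] := real_leP (real0 _) (Creal_Im v).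
    by apply: rootC_Re_max.
  rewrite -Re_conj; apply: rootC_Re_max => //.
    by rewrite -rmorphXn vN rmorphN1.
  by rewrite Im_conj oppr_ge0 ltW.
have u0 : u != 0 by rewrite rootC_eq0 // oppr_eq0 oner_eq0.
have tN : t ^+ N = 1 by rewrite /t exprAC uN sqrrN expr1n.
have [w wP] := C_prim_root_exists (isT : (0 < N * 2)%N).
have wN : w ^+ N = -1.
  have /eqP : (w ^+ N) ^+ 2 = 1 ^+ 2 by rewrite -exprM prim_expr_order // expr1n.
  rewrite eqf_sqr => /orP[/eqP h|/eqP //].
  by have := prim_order_dvd wP N; rewrite h eqxx => /dvdn_leq -/(_ N0); lia.
pose F (j : 'I_N) := 'Re (w * t ^+ j).
have [j _ jmax] : extremum_spec >=%R predT F [arg max_(i > (ord0 : 'I_N)) F i]%O.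
  by apply: real_arg_maxP => // i _; apply: Creal_Re.
have {}jmax k : 'Re (w * t ^+ k) <= 'Re (w * t ^+ j).
  rewrite -(expr_mod k tN); exact: (jmax (Ordinal (ltn_pmod k N0))).
set v := w * t ^+ j in jmax.
have vN : v ^+ N = -1 by rewrite exprMn wN exprAC tN expr1n mulr1.
have H1 : 'Re (v * t) <= 'Re v by rewrite -mulrA -exprSr.
have H2 : 'Re (v * t^*) <= 'Re v.
  have -> : t^* = t ^+ N.-1.
    have tt : t * t^* = 1 by rewrite -normCK normrX norm1 // !expr1n.
    by rewrite -[LHS]mul1r -tN (exprSr t N.-1) -mulrA tt mulr1.
  by rewrite -mulrA -exprD.
have Euv : v = u \/ v = u^*.
  have I0 : 0 <= 'Im u by rewrite Im_rootC_ge0.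
  pose a := in_algR (Creal_Re v); pose b := in_algR (Creal_Im v).
  pose c := in_algR (Creal_Re u); pose e := in_algR (Creal_Im u).
  have Ret : 'Re t = 'Re u ^+ 2 - 'Im u ^+ 2 by rewrite ReM -!expr2.
  have Imt : 'Im t = 2 * 'Re u * 'Im u by rewrite ImM; ring.
  have [|||||||/(congr1 val) /= ac be] := @circle_aux _ a b c e.
  - exact/val_inj/Cnorm.
  - exact/val_inj/Cnorm.
  - apply/eqP => /(congr1 val) /= c1; move: (Cnorm _ uN).
    rewrite c1 expr1n => /eqP; rewrite -subr_eq0 addrAC subrr add0r.
    rewrite expf_eq0 /= => /eqP I_0; move/eqP: uN.
    by rewrite [u]Crect c1 I_0 mulr0 addr0 expr1n eq_sym eqNr oner_eq0.
  - exact: maxu.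
  - exact: I0.
  - by move: H1; rewrite ReM Ret Imt.
  - by move: H2; rewrite ReM Re_conj Im_conj Ret Imt mulrN opprK.
  case: be => /(congr1 val) /= be; [left|right].
    by rewrite [v]Crect ac be -Crect.
  by rewrite [v]Crect [u^*]Crect Re_conj Im_conj ac be.
have wm m : u ^+ m = 1 -> w ^+ m = 1.
  move=> um; have: v ^+ m = 1 by case: Euv => ->; rewrite -?rmorphXn um ?rmorph1.
  by rewrite exprMn exprAC /t (exprAC u) um !expr1n mulr1.
have u2N : u ^+ (N * 2) = 1 by rewrite exprM uN sqrrN expr1n.
have [m uP m_dvd] := prim_order_exists (isT : (0 < N * 2)%N) u2N.
have mE : m = (N * 2)%N.
  apply/eqP; rewrite eqn_dvd m_dvd (prim_order_dvd wP).
  by apply/eqP/wm/prim_expr_order.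
rewrite mE in uP; have := dvdn_prim_root uP (dvdn_mulr 2 (dvdnn N)).
by rewrite mulKn.
Qed.

Lemma sub_Kplus (M N : nat) :
  (0 < N)%N -> (M %| N)%N -> {subset Kplus M <= Kplus N}.
Proof.
move=> N0 MN; have M0 := dvdn_gt0 N0 MN; apply: Qadjoin_sub.
have [i ->] : {i : 'I_N | zeta M = zeta N ^+ i}.
  apply: (prim_rootP (zeta_prim N0)); case/dvdnP: MN => k ->.
  by rewrite mulnC exprM (prim_expr_order (zeta_prim M0)) expr1n.
set z := zeta N; move: (i : nat) => {}i.
have z0 : z != 0.
  apply/eqP => z0; have /eqP := prim_expr_order (zeta_prim N0).
  by rewrite -/z z0 expr0n gtn_eqF // eq_sym oner_eq0.
have [S1 SB SM] := GRing.divring_closedBM (Qadjoin_divring (z + z^-1)).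
have Sz := mem_Qadjoin (z + z^-1).
suff [] : z ^+ i + (z ^+ i)^-1 \in Qadjoin (z + z^-1) /\
          z ^+ i.+1 + (z ^+ i.+1)^-1 \in Qadjoin (z + z^-1) by [].
elim: i => [|i [IH1 IH2]].
  rewrite expr0 expr1 invr1; split=> //.
  by rewrite -[1 in X in _ + X]opprK SB // -(sub0r 1) SB // -(subrr 1) SB.
split=> //; rewrite [X in X \in _](_ : _ =
    (z + z^-1) * (z ^+ i.+1 + (z ^+ i.+1)^-1) - (z ^+ i + (z ^+ i)^-1)).
  by rewrite SB ?SM.
by rewrite !exprS; field; rewrite expf_neq0.
Qed.

Lemma Kplus_pinf_dir (p : nat) (x y : algC) :
  x \in Kplus_pinf p -> y \in Kplus_pinf p ->
  exists n : nat, x \in Kplus (p ^ n) /\ y \in Kplus (p ^ n).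
Proof.
move=> /asboolP[m Kx] /asboolP[n Ky]; case: p => [|p] in Kx Ky *.
  have K1 k : {subset Kplus (0 ^ k) <= Kplus 1}.
    case: k => [//|k]; rewrite exp0n //; apply: Qadjoin_sub.
    have [S1 SB _] := Qadjoin_divring (zeta 1 + (zeta 1)^-1).
    have -> : zeta 0 + (zeta 0)^-1 = 0 by rewrite /zeta root0C expr0n /= invr0 addr0.
    by rewrite -[X in X \in _](subrr 1) SB.
  by exists 0; split; [apply: K1 Kx | apply: K1 Ky].
exists (maxn m n); split; [move: Kx | move: Ky]; apply: sub_Kplus;
  by rewrite ?expn_gt0 // dvdn_exp2l // ?leq_maxl ?leq_maxr.
Qed.

Lemma Kplus_pinf_divring (p : nat) : GRing.divring_closed (Kplus_pinf p).
Proof.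
split=> [|x y Kx Ky|x y Kx Ky].
- apply/asboolP; exists 0.
  by have [] := Qadjoin_divring (zeta (p ^ 0) + (zeta (p ^ 0))^-1).
- have [n [Kx' Ky']] := Kplus_pinf_dir Kx Ky; apply/asboolP; exists n.
  by have [_ SB _] := Qadjoin_divring (zeta (p ^ n) + (zeta (p ^ n))^-1); apply: SB.
- have [n [Kx' Ky']] := Kplus_pinf_dir Kx Ky; apply/asboolP; exists n.
  by have [_ _ SV] := Qadjoin_divring (zeta (p ^ n) + (zeta (p ^ n))^-1); apply: SV.
Qed.

Lemma int_Kplus_pinf_subring (p : nat) :
  GRing.subring_closed (int_Kplus_pinf p).
Proof.
have [K1 KB KM] := GRing.divring_closedBM (Kplus_pinf_divring p).
split=> [|x y|x y].
- by rewrite unfold_in K1; apply/asboolP/integral1.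
- move=> /andP[Kx /asboolP Ix] /andP[Ky /asboolP Iy].
  by rewrite unfold_in KB //; apply/asboolP/integral_sub.
- move=> /andP[Kx /asboolP Ix] /andP[Ky /asboolP Iy].
  by rewrite unfold_in KM //; apply/asboolP/integral_mul.
Qed.

HB.instance Definition _ (p : nat) :=
  GRing.isSubringClosed.Build algC (int_Kplus_pinf p)
    (int_Kplus_pinf_subring p).

Record O_Kplus_pinf (p : nat) : Type :=
  MkO { O_val : algC; _ : O_val \in int_Kplus_pinf p }.

HB.instance Definition _ (p : nat) := [isSub of O_Kplus_pinf p for @O_val p].
HB.instance Definition _ (p : nat) := [Choice of O_Kplus_pinf p by <:].
HB.instance Definition _ (p : nat) :=
  [SubChoice_isSubComNzRing of O_Kplus_pinf p by <:].

(* Main.v *)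
(* Let z be a primitive p^(m+1)-th root of unity and q = p^m. The ring of integers
   Z[z] is graded by Z/q, the component of degree a being z^a Z[z^q], and distinct
   components are orthogonal for the form tr(x x^* ). Take E_l = z^(j_l) + z^(-j_l)
   for l = 0, ..., n. Suppose that E_0^2 + ... + E_n^2 = y_1^2 + ... + y_r^2 with real
   y_k in Z[z]. As 2 is unramified, sum y_k = sum E_l modulo 2, hence each of the
   2(n+1) degrees j_l, -j_l occurs in some y_k. The normalized trace of the sum is
   2(n+1), while by AM-GM each nonzero component of each y_k contributes at least 1.
   So each degree j_l, -j_l occurs in exactly one y_k, and no other degree occurs.
   If r <= n, then some y_k involves two distinct degrees j_l and j_l'; for a Sidon
   set of exponents the component of degree j_l + j_l' of the right-hand side is then
   twice the product of two nonzero elements, while that of the left-hand side is 0. *)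
From HB Require Import structures.
Require Import Defs.
From mathcomp Require Import all_boot all_order all_algebra all_field.
From mathcomp Require Import ring lra zify.
From mathcomp Require Import boolp.

Set Implicit Arguments.
Unset Strict Implicit.
Unset Printing Implicit Defensive.

Import Order.TTheory GRing.Theory Num.Theory.

(** * Subrings generated by one algebraic number, their automorphisms, and roots of unity *)

Section CyclotomicIntegers.
Local Open Scope ring_scope.

Lemma exprD_prime (R : comNzRingType) (p : nat) (x y : R) :
  prime p -> exists w, (x + y) ^+ p = x ^+ p + y ^+ p + p%:R * w.
Proof.
case: p => [|p] // pP; rewrite exprDn big_ord_recl big_ord_recr /=.
rewrite subn0 expr0 mulr1 bin0 mulr1n subnn expr0 mul1r binn mulr1n.
exists (\sum_(i < p) x ^+ (p.+1 - i.+1) * y ^+ i.+1 *+ ('C(p.+1, i.+1) %/ p.+1)).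
rewrite mulr_sumr -addrA; congr (_ + _); rewrite addrC; congr (_ + _).
apply: eq_bigr => i _; rewrite mulr_natl -mulrnA /bump /=.
by rewrite divnK // prime_dvd_bin //= ltnS ltn_ord.
Qed.

(** Iterated Frobenius modulo p. Evaluated at a root of unity z of p-power order, it makes a power
    of 1 - z divisible by p. *)
Lemma expr_1B_prime_pow (R : comNzRingType) (p k : nat) (x : R) :
  prime p -> odd p ->
  exists w, (1 - x) ^+ (p ^ k) = 1 - x ^+ (p ^ k) + p%:R * w.
Proof.
move=> pP p_odd; elim: k => [|k [w IH]].
  by exists 0; rewrite mulr0 addr0 !expr1.
have [w1 E1] := exprD_prime (1 - x ^+ (p ^ k)) (p%:R * w) pP.
have [w2 E2] := exprD_prime 1 (- x ^+ (p ^ k)) pP.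
exists (w1 + w2 + p%:R ^+ p.-1 * w ^+ p).
rewrite expnSr exprM IH E1 E2 expr1n exprNn -signr_odd p_odd expr1 mulN1r.
have -> : (p%:R * w) ^+ p = p%:R * (p%:R ^+ p.-1 * w ^+ p).
  by rewrite mulrA -exprS prednK ?prime_gt0 // exprMn.
by rewrite (exprM x) !mulrDr; ring.
Qed.

Definition Zadjoin (z : algC) : {pred algC} :=
  fun x => `[< exists f : {poly int}, x = (map_poly intr f).[z] >].

Lemma ZadjoinP (z x : algC) :
  reflect (exists f : {poly int}, x = (map_poly intr f).[z]) (x \in Zadjoin z).
Proof. exact: asboolP. Qed.

Lemma Zadjoin_subring (z : algC) : GRing.subring_closed (Zadjoin z).
Proof.
split=> [|x y /ZadjoinP[f ->] /ZadjoinP[g ->]|x y /ZadjoinP[f ->] /ZadjoinP[g ->]].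
- by apply/ZadjoinP; exists 1; rewrite rmorph1 hornerC.
- by apply/ZadjoinP; exists (f - g); rewrite rmorphB hornerD hornerN.
- by apply/ZadjoinP; exists (f * g); rewrite rmorphM hornerM.
Qed.

HB.instance Definition _ (z : algC) :=
  GRing.isSubringClosed.Build algC (Zadjoin z) (Zadjoin_subring z).

Lemma mem_Zadjoin (z : algC) : z \in Zadjoin z.
Proof. by apply/ZadjoinP; exists 'X; rewrite map_polyX hornerX. Qed.

(** Induction along Horner's scheme: facts about Z[z] are checked on integers and on one
    multiplication by z. *)
Lemma Zadjoin_ind (z : algC) (P : algC -> Prop) :
    (forall m : int, P m%:~R) ->
    (forall x (m : int), x \in Zadjoin z -> P x -> P (x * z + m%:~R)) ->
  forall x, x \in Zadjoin z -> P x.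
Proof.
move=> P0 P1 x /ZadjoinP[f ->]; elim/poly_ind: f => [|f c IH].
  by rewrite map_poly0 horner0; exact: (P0 0).
rewrite rmorphD rmorphM /= map_polyX map_polyC /= hornerD hornerMX hornerC.
by apply: P1 => //; apply/ZadjoinP; exists f.
Qed.

Lemma Zadjoin_sub_Aint (z : algC) : z \in Aint -> {subset Zadjoin z <= Aint}.
Proof.
by move=> zA; apply: Zadjoin_ind => [m|x m _ xA]; rewrite ?rpredD ?rpredM ?Aint_int.
Qed.

Lemma Zadjoin_rmorph_eq (z : algC) (u v : {rmorphism algC -> algC}) :
  u z = v z -> {in Zadjoin z, u =1 v}.
Proof.
move=> uv; apply: Zadjoin_ind => [m|x m _ IH]; first by rewrite !rmorph_int.
by rewrite !rmorphD !rmorphM /= IH uv !rmorph_int.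
Qed.

Lemma Zadjoin_rmorph (z : algC) (u : {rmorphism algC -> algC}) :
  u z \in Zadjoin z -> {in Zadjoin z, forall x, u x \in Zadjoin z}.
Proof.
move=> uz; apply: Zadjoin_ind => [m|x m _ IH]; first by rewrite rmorph_int rpred_int.
by rewrite rmorphD rmorphM /= rmorph_int rpredD ?rpredM ?rpred_int.
Qed.

(* The identity is a junk value: [k] is always coprime to [N] below. *)
Definition gal (N k : nat) : {rmorphism algC -> algC} :=
  if @idP (coprime k N) is ReflectT h then sval (Qn_aut_exists h) else idfun.

Lemma galE (N k : nat) (x : algC) :
  coprime k N -> x ^+ N = 1 -> gal N k x = x ^+ k.
Proof.
move=> kN xN; rewrite /gal; case: {-}_ / idP => [h|/(_ kN)//].
by case: (Qn_aut_exists h) => u /= ->.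
Qed.

Lemma sum_expr_root_of_unity (N : nat) (w : algC) :
  w ^+ N = 1 -> w != 1 -> \sum_(j < N) w ^+ j = 0.
Proof.
move=> wN w1; apply: (mulfI (x := w - 1)); first by rewrite subr_eq0.
by rewrite mulr0 -subrX1 wN subrr.
Qed.

Lemma prim_root_neq0 (N : nat) (z : algC) : N.-primitive_root z -> z != 0.
Proof.
move=> zP; apply/eqP => z0; have := prim_expr_order zP.
by rewrite z0 expr0n gtn_eqF ?(prim_order_gt0 zP) // => /eqP; rewrite eq_sym oner_eq0.
Qed.

Lemma prim_root_unitr (N : nat) (z : algC) :
  N.-primitive_root z -> z \is a GRing.unit.
Proof. by move=> zP; rewrite unitfE (prim_root_neq0 zP). Qed.

Lemma prim_root_inv (N : nat) (z : algC) : N.-primitive_root z -> z^-1 = z ^+ N.-1.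
Proof.
move=> zP; apply: (mulrI (prim_root_unitr zP)).
rewrite divrr ?(prim_root_unitr zP) // -exprS prednK ?(prim_order_gt0 zP) //.
by rewrite (prim_expr_order zP).
Qed.

Lemma prim_root_conj (N : nat) (z : algC) : N.-primitive_root z -> z^* = z^-1.
Proof.
move=> zP; suff z1 : `|z| = 1 by rewrite invC_norm z1 expr1n invr1 mul1r.
apply/eqP; rewrite -(pexpr_eq1 (prim_order_gt0 zP)) ?normr_ge0 //.
by rewrite -normrX (prim_expr_order zP) normr1.
Qed.

End CyclotomicIntegers.

(** * Norms, traces and denominators in Z[z] *)

Section PrimitiveRoot.
Local Open Scope ring_scope.
Context (N : nat) (z : algC) (N_gt1 : (1 < N)%N) (zP : N.-primitive_root z).

Let zN : z ^+ N = 1 := prim_expr_order zP.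
Let Zz_z := mem_Zadjoin z.

Lemma prim_root_Zadjoin_Aint : {subset Zadjoin z <= Aint}.
Proof. exact: Zadjoin_sub_Aint (Aint_prim_root zP). Qed.

Lemma Zadjoin_inv : z^-1 \in Zadjoin z.
Proof. by rewrite (prim_root_inv zP) rpredX. Qed.

Lemma gal_prim (k : nat) : coprime k N -> gal N k z = z ^+ k.
Proof. by move=> kN; rewrite galE. Qed.

Lemma Zadjoin_gal (k : nat) :
  coprime k N -> {in Zadjoin z, forall x, gal N k x \in Zadjoin z}.
Proof. by move=> kN; apply: Zadjoin_rmorph; rewrite gal_prim // rpredX. Qed.

(** Conjugation inverts z, so both composites send z to z^-k, and agreement at z extends to Z[z]. *)
Lemma gal_conj (k : nat) :
  coprime k N -> {in Zadjoin z, forall x, (gal N k x)^* = gal N k x^*}.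
Proof.
move=> kN x xZ.
apply: (Zadjoin_rmorph_eq (u := Num.conj \o gal N k) (v := gal N k \o Num.conj) _ xZ).
by rewrite /= gal_prim // rmorphXn /= (prim_root_conj zP) fmorphV gal_prim // exprVn.
Qed.

Lemma coprime_unit (s : {unit 'Z_N}) : coprime (val s) N.
Proof.
by have := valP s; rewrite -[val s]natr_Zp unitZpE // coprime_sym natr_Zp.
Qed.

(** The units of Z/N stand for the Galois group of Q(z)/Q: this finite group indexes norms and
    traces, and its translations reindex them. *)
Definition ugal (s : {unit 'Z_N}) : {rmorphism algC -> algC} := gal N (val s : 'Z_N).

Lemma ugal_prim s : ugal s z = z ^+ (val s : 'Z_N).
Proof. exact/gal_prim/coprime_unit. Qed.

Lemma Zadjoin_ugal s : {in Zadjoin z, forall x, ugal s x \in Zadjoin z}.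
Proof. exact/Zadjoin_gal/coprime_unit. Qed.

Lemma ugal_conj s : {in Zadjoin z, forall x, (ugal s x)^* = ugal s x^*}.
Proof. exact/gal_conj/coprime_unit. Qed.

Lemma ugalM r s : {in Zadjoin z, forall x, ugal r (ugal s x) = ugal (r * s)%g x}.
Proof.
move=> x xZ; apply: (Zadjoin_rmorph_eq (u := ugal r \o ugal s) (v := ugal _) _ xZ).
rewrite /= !ugal_prim rmorphXn /= ugal_prim -exprM.
apply/eqP; rewrite (eq_prim_root_expr zP) /=.
have modE m : (m %% (Zp_trunc N).+2 = m %% N)%N by rewrite Zp_cast.
by rewrite modE modn_mod.
Qed.

Lemma card_unit_Zp : #|{: {unit 'Z_N}}| = totient N.
Proof. by rewrite -(card_units_Zp (ltnW N_gt1)) cardsT. Qed.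

(* Modulo the N-th cyclotomic polynomial, x is g(z) with deg g < phi(N), and g - x
   has phi(N) roots. *)
Lemma ugal_fixed_int x :
  x \in Zadjoin z -> (forall s, ugal s x = x) -> x \is a Num.int.
Proof.
move=> /ZadjoinP[f xE] xfix.
pose g := Pdiv.Ring.rmodp f 'Phi_N.
have xg : x = (map_poly intr g).[z].
  rewrite xE [in LHS](Pdiv.RingMonic.rdivp_eq (Cyclotomic_monic N) f) rmorphD rmorphM /=.
  rewrite (Cintr_Cyclotomic zP) hornerD hornerM.
  have /rootP -> : root (cyclotomic z N) z by rewrite root_cyclotomic.
  by rewrite mulr0 add0r.
pose G : {poly algC} := map_poly intr g - x%:P.
have szg : (size g <= totient N)%N.
  rewrite -ltnS -size_Cyclotomic Pdiv.Ring.ltn_rmodpN0 //.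
  exact/monic_neq0/Cyclotomic_monic.
have szG : (size G <= totient N)%N.
  rewrite (leq_trans (size_polyD _ _)) // geq_max (leq_trans (size_poly _ _)) //.
  rewrite size_polyN (leq_trans (size_polyC_leq1 _)) //.
  by rewrite totient_gt0 ltnW.
have G0 : G = 0.
  apply/eqP/negP => /negP G0.
  have := @max_poly_roots _ G [seq ugal s z | s : {unit 'Z_N}] G0.
  rewrite size_image card_unit_Zp ltnNge szG => /(_ _ _)/negP; apply=> //.
    apply/allP => _ /imageP[s _ ->]; apply/rootP.
    rewrite hornerD hornerN hornerC -(xfix s) xg -horner_map /= -map_poly_comp.
    rewrite (eq_map_poly (g := intr)) ?subrr // => m /=; exact: rmorph_int.
  rewrite /image_mem map_inj_uniq ?enum_uniq // => r s.
  have ltN (i : 'Z_N) : (i < N)%N by rewrite -[X in (_ < X)%N](Zp_cast N_gt1).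
  rewrite !ugal_prim => /eqP; rewrite (eq_prim_root_expr zP) !modn_small ?ltN //.
  by move=> /eqP/val_inj/val_inj.
have : G`_0 = 0 by rewrite G0 coef0.
rewrite coefB coefC coef_map /= => /eqP; rewrite subr_eq0 => /eqP <-.
exact: intr_int.
Qed.

Lemma ugal_prod_int x :
  x \in Zadjoin z -> \prod_s ugal s x \is a Num.int.
Proof.
move=> xZ; apply: ugal_fixed_int => [|r].
  by rewrite rpred_prod // => s _; apply: Zadjoin_ugal.
rewrite rmorph_prod [RHS](reindex_inj (mulgI r)) /=.
by apply: eq_bigr => s _; rewrite ugalM.
Qed.

Lemma ugal_prod_neq0 x : x != 0 -> \prod_s ugal s x != 0.
Proof. by move=> x0; apply/prodf_neq0 => s _; rewrite fmorph_eq0. Qed.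

(** By AM-GM, the mean raised to the power phi(N) is at least the squared absolute value of the norm
    of x, a nonzero integer. *)
Lemma sum_ugal_norm_ge x : x \in Zadjoin z -> x != 0 ->
  (totient N)%:R <= \sum_s `|ugal s x| ^+ 2.
Proof.
move=> xZ x0.
have phi_gt0 : (0 < totient N)%N by rewrite totient_gt0 ltnW.
have [/= + _] := leif_AGM (A := predT) (E := fun s => `|ugal s x| ^+ 2)
  (fun s _ => exprn_ge0 2 (normr_ge0 _)).
rewrite card_unit_Zp prodrXl -normr_prod => AGM.
have : 1 <= (\sum_s `|ugal s x| ^+ 2 / (totient N)%:R) ^+ totient N.
  rewrite -mulr_suml; apply: le_trans AGM; rewrite exprn_ege1 //.
  by rewrite norm_intr_ge1 ?ugal_prod_int ?ugal_prod_neq0.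
rewrite -mulr_suml expr_ge1 //; first by rewrite ler_pdivlMr ?ltr0n // mul1r.
by rewrite divr_ge0 ?ler0n // sumr_ge0 // => s _; rewrite exprn_ge0.
Qed.

Lemma ugal1_prim : ugal 1 z = z.
Proof. by rewrite ugal_prim /= modn_small ?expr1 ?Zp_cast. Qed.

(** Numbers with an integer denominator form a subfield: the inverse of a nonzero w in Z[z] is the
    product of its other conjugates divided by its norm, an integer. *)
Lemma Qadjoin_Zadjoin x : x \in Qadjoin z ->
  exists2 m : int, m != 0 & m%:~R * x \in Zadjoin z.
Proof.
pose S : {pred algC} :=
  fun x => `[< exists2 m : int, m != 0 & m%:~R * x \in Zadjoin z >].
suff Sdiv : GRing.divring_closed S.
  move=> /QadjoinP/(_ S Sdiv) Sx; apply/asboolP/Sx/asboolP.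
  by exists 1 => //; rewrite mul1r.
split=> [|{x}x y /asboolP[m m0 mx] /asboolP[n n0 ny]|
          {x}x y /asboolP[m m0 mx] /asboolP[n n0 ny]]; apply/asboolP.
- by exists 1 => //; rewrite mul1r rpred1.
- exists (m * n); first by rewrite mulf_neq0.
  have -> : (m * n)%:~R * (x - y) = n%:~R * (m%:~R * x) - m%:~R * (n%:~R * y).
    by rewrite rmorphM /=; ring.
  by apply: rpredB; apply: rpredM => //; rewrite rpred_int.
have [->|y0] := eqVneq y 0; first by exists 1 => //; rewrite invr0 !mulr0 rpred0.
set w := n%:~R * y in ny; have w0 : w != 0 by rewrite mulf_neq0 ?intr_eq0.
have /intrP[k kE] := ugal_prod_int ny.
have k0 : k != 0 by rewrite -(intr_eq0 algC) -kE ugal_prod_neq0.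
exists (m * k); first by rewrite mulf_neq0.
have -> : (m * k)%:~R * (x / y) =
    n%:~R * (m%:~R * x) * \prod_(s : {unit 'Z_N} | s != 1%g) ugal s w.
  have w1 : ugal 1 w = w.
    apply: (Zadjoin_rmorph_eq (v := idfun) _ ny).
    exact: ugal1_prim.
  rewrite rmorphM /= -kE (bigD1 (1%g : {unit 'Z_N})) //= w1 /w.
  by field.
apply: rpredM; first by apply: rpredM => //; rewrite rpred_int.
by rewrite rpred_prod // => s _; apply: Zadjoin_ugal.
Qed.

Lemma ugal_sum_int x : x \in Zadjoin z -> \sum_s ugal s x \is a Num.int.
Proof.
move=> xZ; apply: ugal_fixed_int => [|r].
  by rewrite rpred_sum // => s _; apply: Zadjoin_ugal.
rewrite rmorph_sum [RHS](reindex_inj (mulgI r)) /=.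
by apply: eq_bigr => s _; rewrite ugalM.
Qed.

(** Clearing the denominator of x shows its trace to be rational; the trace is also an algebraic
    integer. *)
Lemma ugal_sum_Aint_int x :
  x \in Qadjoin z -> x \in Aint -> \sum_s ugal s x \is a Num.int.
Proof.
move=> /Qadjoin_Zadjoin[m m0 /ugal_sum_int].
under eq_bigr do rewrite rmorphM /= rmorph_int.
rewrite -mulr_sumr => /intrP[k mT] xA; apply: Cint_rat_Aint.
  have m0' : m%:~R != 0 :> algC by rewrite intr_eq0.
  by rewrite -[X in X \in _](mulKf m0') mT rpredM ?rpredV ?rpred_int.
by rewrite rpred_sum // => s _; rewrite Aint_aut.
Qed.

Lemma Qadjoin_rmorph_eq (u v : {rmorphism algC -> algC}) :
  u z = v z -> {in Qadjoin z, u =1 v}.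
Proof.
move=> uv x /Qadjoin_Zadjoin[m m0 mx]; have := Zadjoin_rmorph_eq uv mx.
by rewrite !rmorphM /= !rmorph_int => /mulfI; apply; rewrite intr_eq0.
Qed.

(** Fourier inversion: N x is the sum over j < N of Tr(x z^-j) z^j, with integer traces. *)
Lemma mulrN_Aint_Zadjoin x :
  x \in Qadjoin z -> x \in Aint -> N%:R * x \in Zadjoin z.
Proof.
move=> xQ xA; have [_ _ QV] := Qadjoin_divring z.
have [_ _ QM] := GRing.divring_closedBM (Qadjoin_divring z).
have Qzj j : z ^- j \in Qadjoin z.
  elim: j => [|j IH]; first by rewrite expr0 invr1; case: (Qadjoin_divring z).
  by rewrite exprS invfM -mulrC QV ?mem_Qadjoin.
have -> : N%:R * x = \sum_(j < N) (\sum_s ugal s (x * z ^- j)) * z ^+ j.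
  (* Once the sums are exchanged, each s carries the geometric sum of the N-th root of unity
     [ugal s z^-1 * z], which is 1 only for s = 1. *)
  transitivity (\sum_s ugal s x * \sum_(j < N) (ugal s z^-1 * z) ^+ j); last first.
    under [RHS]eq_bigr do rewrite mulr_suml.
    rewrite [RHS]exchange_big /=.
    apply: eq_bigr => s _; rewrite mulr_sumr; apply: eq_bigr => j _.
    by rewrite rmorphM /= exprMn -rmorphXn exprVn /= mulrA.
  rewrite (bigD1 (1%g : {unit 'Z_N})) //= [X in _ + X]big1 ?addr0 => [|s s1].
    rewrite (Qadjoin_rmorph_eq (v := idfun) ugal1_prim xQ) fmorphV ugal1_prim.
    rewrite mulVr ?(prim_root_unitr zP) //.
    under eq_bigr do rewrite expr1n.
    by rewrite sumr_const card_ord mulrC.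
  rewrite sum_expr_root_of_unity ?mulr0 //.
    by rewrite exprMn -rmorphXn exprVn zN invr1 rmorph1 mulr1.
  apply: contra s1; rewrite fmorphV ugal_prim.
  rewrite -(inj_eq (mulrI (unitrX (val s) (prim_root_unitr zP)))) mulrA.
  rewrite divrr ?unitrX ?(prim_root_unitr zP) // mul1r mulr1 -[X in X == _]expr1.
  rewrite (eq_prim_root_expr zP) !modn_small //.
    by rewrite eq_sym => /eqP s1; apply/eqP/val_inj/val_inj; apply: (etrans s1); rewrite /= modn_small // Zp_cast.
  by rewrite -[X in (_ < X)%N](Zp_cast N_gt1).
rewrite rpred_sum // => j _; rewrite rpredM ?rpredX //.
have /intrP[k ->] : \sum_s ugal s (x * z ^- j) \is a Num.int.
  rewrite ugal_sum_Aint_int ?QM // rpredM // -exprVn rpredX //.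
  by rewrite prim_root_Zadjoin_Aint ?Zadjoin_inv.
exact: rpred_int.
Qed.

End PrimitiveRoot.

(** * Prime power order: Z[z] contains every algebraic integer of Q(z) *)

Section PrimePower.
Local Open Scope ring_scope.
Context (p m : nat) (p_prime : prime p) (p_odd : odd p).
Local Notation N := (p ^ m.+1)%N.
Local Notation q := (p ^ m)%N.
Context (z : algC) (zP : N.-primitive_root z).

Let p_gt1 : (1 < p)%N := prime_gt1 p_prime.
Let q_gt0 : (0 < q)%N. Proof. by rewrite expn_gt0 prime_gt0. Qed.
Let NE : N = (p * q)%N. Proof. exact: expnS. Qed.
Let N_gt1 : (1 < N)%N. Proof. by rewrite NE; nia. Qed.
Let zN : z ^+ N = 1 := prim_expr_order zP.

Lemma expr_1B_prim_root :
  exists2 w, w \in Zadjoin z & (1 - z) ^+ N = p%:R * w.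
Proof.
have [w wE] := expr_1B_prime_pow m.+1 ('X : {poly int}) p_prime p_odd.
exists (map_poly intr w).[z]; first by apply/ZadjoinP; exists w.
have := congr1 (fun f : {poly int} => (map_poly intr f).[z]) wE.
rewrite !(rmorphXn, rmorphB, rmorphD, rmorphM, rmorph1, rmorph_nat) /= map_polyX.
rewrite !(horner_exp, hornerD, hornerN, hornerM, hornerXn, hornerX, hornerC).
by rewrite zN subrr add0r -polyC_natr hornerC.
Qed.

(** The z^(qt) with t < p sum to 0, so p is the sum of the 1 - z^(qt), each divisible by 1 - z. *)
Lemma prime_dvd_1B_prim_root :
  exists2 w, w \in Zadjoin z & p%:R = (1 - z) * w.
Proof.
have w1 : z ^+ q != 1.
  rewrite -(prim_order_dvd zP); apply: contraTN p_gt1 => /(dvdn_leq q_gt0).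
  by rewrite NE; nia.
have sum0 : \sum_(t < p) (z ^+ q) ^+ t = 0.
  by rewrite sum_expr_root_of_unity // -exprM -expnSr zN.
exists (\sum_(t < p) \sum_(i < q * t) z ^+ i).
  by rewrite !rpred_sum // => t _; rewrite rpred_sum // => i _; rewrite rpredX ?mem_Zadjoin.
have -> : p%:R = \sum_(t < p) (1 - (z ^+ q) ^+ t).
  by rewrite sumrB sum0 subr0 sumr_const card_ord.
rewrite mulr_sumr.
apply: eq_bigr => t _; rewrite -exprM.
by rewrite -opprB subrX1 -mulNr opprB.
Qed.

Lemma Zadjoin_mod_1B x :
  x \in Zadjoin z -> exists (c : int) y, y \in Zadjoin z /\ x = c%:~R + (1 - z) * y.
Proof.
move: x; apply: Zadjoin_ind => [c|x c xZ [d [y [yZ xE]]]].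
  by exists c, 0; rewrite mulr0 addr0 rpred0.
exists (d + c), (y - x); split; first by rewrite rpredB.
have yE : (1 - z) * y = x - d%:~R by rewrite [in RHS]xE addrAC subrr add0r.
by rewrite rmorphD mulrBr yE /=; ring.
Qed.

(* If (1 - z) x = c + (1 - z) y with c an integer, then c / (1 - z) is integral; as p
   divides (1 - z)^N, so is c^N / p, whence p, and thus 1 - z, divides c. *)
Lemma Aint_mul1B_Zadjoin x :
  x \in Aint -> (1 - z) * x \in Zadjoin z -> x \in Zadjoin z.
Proof.
move=> xA /Zadjoin_mod_1B[c [y [yZ xE]]].
have ZA := prim_root_Zadjoin_Aint zP.
have [w wZ wE] := expr_1B_prim_root; have [v vZ vE] := prime_dvd_1B_prim_root.
have p0 : p%:R != 0 :> algC by rewrite pnatr_eq0 -lt0n prime_gt0.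
have pi0 : 1 - z != 0 by apply: contraNneq p0 => pi0; rewrite vE pi0 mul0r.
have cE : c%:~R = (1 - z) * (x - y) by rewrite mulrBr xE addrK.
have /intrP[k kE] : (c%:~R : algC) ^+ N / p%:R \is a Num.int.
  apply: Cint_rat_Aint; first by rewrite rpredM ?rpredV ?rpredX ?rpred_nat ?rpred_int.
  rewrite cE exprMn wE -[_ * w * _]mulrA [p%:R * _]mulrC mulfK //.
  by apply: rpredM; rewrite ?rpredX ?rpredB // ZA.
have /dvdzP[d dE] : (p %| c)%Z.
  suff : (p %| `|c| ^ N)%N by rewrite Euclid_dvdX // => /andP[].
  have : (c ^+ N = k * p)%R by apply/(@intr_inj algC); rewrite rmorphXn rmorphM /= -kE divfK.
  by move=> /(congr1 absz); rewrite abszX abszM => ->; rewrite dvdn_mull.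
have -> : x = d%:~R * v + y.
  apply: (mulfI pi0); rewrite xE dE rmorphM /= [X in _ * X]vE; ring.
by rewrite rpredD // rpredM ?rpred_int.
Qed.

(** N x lies in Z[z], and N = p^(m+1) divides (1 - z)^(N(m+1)); the factors 1 - z are then removed
    one at a time. *)
Lemma Aint_Qadjoin_Zadjoin x :
  x \in Qadjoin z -> x \in Aint -> x \in Zadjoin z.
Proof.
move=> xQ xA; have [w wZ wE] := expr_1B_prim_root.
have piA : 1 - z \in Aint by rewrite rpredB // (Aint_prim_root zP).
have: (1 - z) ^+ (N * m.+1) * x \in Zadjoin z.
  rewrite exprM wE exprMn mulrAC -natrX mulrC rpredM ?rpredX //.
  exact: mulrN_Aint_Zadjoin.
elim: (N * m.+1)%N => [|k IH]; first by rewrite mul1r.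
rewrite exprS -mulrA => /Aint_mul1B_Zadjoin; rewrite rpredM ?rpredX // => /(_ isT).
exact: IH.
Qed.

(** * The grading of Z[z] by Z/q *)

Lemma coprime_1D_mul (t : nat) : coprime (1 + p * t) N.
Proof. by rewrite coprime_sym coprime_pexpl // prime_coprime // dvdn_addl ?dvdn_mulr // dvdn1 gtn_eqF. Qed.

(* Eigenvectors of Gal(Q(z)/Q(z^q)), which is cyclic of order q; those of
   eigenvalue z^(pa) in Z[z] form the module z^a Z[z^q]. *)
Definition eigen (v x : algC) := forall t : nat, gal N (1 + p * t) x = v ^+ t * x.

(** The character projector: on a polynomial in z it keeps the monomials with exponent congruent to
    a modulo q. *)
Definition proj (a : nat) (x : algC) : algC :=
  q%:R^-1 * \sum_(t < q) z ^- (p * a * t) * gal N (1 + p * t) x.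

Lemma eigenD v x y : eigen v x -> eigen v y -> eigen v (x + y).
Proof. by move=> xv yv t; rewrite rmorphD /= xv yv mulrDr. Qed.

Lemma eigenM v w x y : eigen v x -> eigen w y -> eigen (v * w) (x * y).
Proof. by move=> xv yw t; rewrite rmorphM /= xv yw exprMn mulrACA. Qed.

Lemma eigen_int (c : int) : eigen 1 c%:~R.
Proof. by move=> t; rewrite rmorph_int expr1n mul1r. Qed.

Lemma eigen_prim : eigen (z ^+ p) z.
Proof.
by move=> t; rewrite galE ?coprime_1D_mul // exprD expr1 mulrC exprM.
Qed.

Lemma eigenX (k : nat) : eigen (z ^+ (p * k)) (z ^+ k).
Proof.
elim: k => [|k IH]; first by rewrite muln0 expr0; exact: (eigen_int 1).
by rewrite mulnS exprD exprS; apply: eigenM IH; apply: eigen_prim.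
Qed.

Lemma eigen_conj v x : x \in Zadjoin z -> eigen v x -> eigen v^* x^*.
Proof.
move=> xZ xv t; rewrite -(gal_conj zP (coprime_1D_mul t)) // xv.
by rewrite rmorphM rmorphXn.
Qed.

Lemma eq_prim_expr_mulp (a b : nat) : (z ^+ (p * a) == z ^+ (p * b)) = (a == b %[mod q]).
Proof.
by rewrite (eq_prim_root_expr zP) NE -!muln_modr eqn_pmul2l // prime_gt0.
Qed.

(** Orthogonality of characters: v z^(-pa) is a q-th root of unity, whose powers of exponent t < q
    sum to q or to 0. *)
Lemma proj_eigen (a : nat) v x :
  v ^+ q = 1 -> eigen v x -> proj a x = (v == z ^+ (p * a))%:R * x.
Proof.
move=> vq xv; have zu := prim_root_unitr zP.
have q0 : q%:R != 0 :> algC by rewrite pnatr_eq0 -lt0n.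
have -> : proj a x = q%:R^-1 * ((\sum_(t < q) (z ^- (p * a) * v) ^+ t) * x).
  rewrite mulr_suml; congr (_ * _); apply: eq_bigr => t _.
  by rewrite xv exprMn exprVn -exprM mulrA.
have [->|vz] := eqVneq.
  rewrite mulVr ?unitrX //; under eq_bigr do rewrite expr1n.
  by rewrite sumr_const card_ord mulrA mulVf // mul1r.
rewrite sum_expr_root_of_unity ?mul0r ?mulr0 //.
  by rewrite exprMn vq mulr1 exprVn -exprM mulnAC -NE exprM zN expr1n invr1.
apply: contra vz => /eqP w1.
by rewrite -[v](mulVKr (x := z ^+ (p * a))) ?unitrX // w1 mulr1.
Qed.

Lemma proj_sum (I : finType) (P : pred I) (a : nat) (F : I -> algC) :
  proj a (\sum_(i | P i) F i) = \sum_(i | P i) proj a (F i).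
Proof.
rewrite -mulr_sumr exchange_big /=; congr (_ * _); apply: eq_bigr => t _.
by rewrite rmorph_sum mulr_sumr.
Qed.

Lemma projD (a : nat) x y : proj a (x + y) = proj a x + proj a y.
Proof.
rewrite -mulrDr -big_split; congr (_ * _); apply: eq_bigr => t _.
by rewrite rmorphD mulrDr.
Qed.

Lemma projZnat (a k : nat) x : proj a (k%:R * x) = k%:R * proj a x.
Proof.
rewrite mulrCA; congr (_ * _); rewrite mulr_sumr; apply: eq_bigr => t _.
by rewrite rmorphM rmorph_nat mulrCA.
Qed.

Lemma prim_expr_mulp_q (a : nat) : (z ^+ (p * a)) ^+ q = 1.
Proof. by rewrite -exprM mulnAC -NE exprM zN expr1n. Qed.

Lemma projX (a k : nat) : proj a (z ^+ k) = (k == a %[mod q])%:R * z ^+ k.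
Proof.
rewrite (proj_eigen a (prim_expr_mulp_q k) (eigenX k)).
by rewrite eq_prim_expr_mulp.
Qed.

(** In Horner's scheme, multiplication by z shifts degrees cyclically, and the new constant enters
    in degree 0. *)
Lemma Zadjoin_homog_sum x : x \in Zadjoin z ->
  exists c : 'I_q -> algC,
    [/\ forall a, c a \in Zadjoin z, forall a : 'I_q, eigen (z ^+ (p * a)) (c a)
      & x = \sum_a c a].
Proof.
move: x; apply: Zadjoin_ind => [k|x k xZ [c [cZ ce ->]]].
  exists (fun a => if a == Ordinal q_gt0 then k%:~R else 0); split=> [a|a|].
  - by case: ifP; rewrite ?rpred0 ?rpred_int.
  - case: eqP => [->|_]; first by rewrite muln0; exact: eigen_int.
    by move=> t; rewrite rmorph0 mulr0.
  - by rewrite -big_mkcond big_pred1_eq.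
exists (fun a => c (ord_pred a) * z + (if a == Ordinal q_gt0 then k%:~R else 0)).
split=> [a|a|].
- by rewrite rpredD ?rpredM ?cZ ?mem_Zadjoin //; case: ifP; rewrite ?rpred0 ?rpred_int.
- apply: eigenD; last first.
    case: eqP => [->|_]; first by rewrite muln0; exact: eigen_int.
    by move=> t; rewrite rmorph0 mulr0.
  have -> : z ^+ (p * a) = z ^+ (p * (ord_pred a)) * z ^+ p.
    rewrite -exprD -mulnSr; apply/eqP; rewrite eq_prim_expr_mulp.
    by rewrite modn_small // eq_sym; apply/eqP/(congr1 val (ord_predK a)).
  exact: eigenM (ce _) eigen_prim.
- rewrite big_split /= -big_mkcond big_pred1_eq; congr (_ + _).
  rewrite mulr_suml [LHS](reindex_inj (h := @ord_pred q)) //.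
  exact: can_inj (@ord_predK q).
Qed.

Lemma proj_homog_sum (c : 'I_q -> algC) (a : 'I_q) :
  (forall b : 'I_q, eigen (z ^+ (p * b)) (c b)) -> proj a (\sum_b c b) = c a.
Proof.
move=> ce; rewrite proj_sum (bigD1 a) //= big1 => [|b ba].
  by rewrite (proj_eigen _ (prim_expr_mulp_q a)) ?eqxx ?mul1r ?addr0.
rewrite (proj_eigen _ (prim_expr_mulp_q b)) // eq_prim_expr_mulp !modn_small //.
by rewrite (negPf (ba : val b != val a)) mul0r.
Qed.

(** Despite the factor 1/q in [proj], no denominator appears: the projection is one of the
    homogeneous components. *)
Lemma Zadjoin_proj (a : 'I_q) x : x \in Zadjoin z -> proj a x \in Zadjoin z.
Proof. by move=> /Zadjoin_homog_sum[c [cZ ce ->]]; rewrite proj_homog_sum. Qed.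

Lemma eigen_projP (a : 'I_q) x :
  x \in Zadjoin z -> eigen (z ^+ (p * a)) (proj a x).
Proof. by move=> /Zadjoin_homog_sum[c [cZ ce ->]]; rewrite proj_homog_sum. Qed.

Lemma sum_proj x : x \in Zadjoin z -> x = \sum_(a < q) proj a x.
Proof.
move=> /Zadjoin_homog_sum[c [cZ ce ->]].
by apply: eq_bigr => a _; rewrite proj_homog_sum.
Qed.

Lemma proj_mul (d : nat) x y : x \in Zadjoin z -> y \in Zadjoin z ->
  proj d (x * y) =
    \sum_(a < q) \sum_(b < q) (a + b == d %[mod q])%:R * (proj a x * proj b y).
Proof.
move=> xZ yZ; rewrite {1}(sum_proj xZ) {1}(sum_proj yZ) mulr_suml proj_sum.
apply: eq_bigr => a _; rewrite mulr_sumr proj_sum; apply: eq_bigr => b _.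
rewrite (proj_eigen _ (v := z ^+ (p * (a + b)))) ?prim_expr_mulp_q //.
  by rewrite eq_prim_expr_mulp.
by rewrite mulnDr exprD; apply: eigenM; apply: eigen_projP.
Qed.

(** A component of degree a times the conjugate of one of degree b has degree a - b, so only
    diagonal terms reach degree 0. *)
Lemma proj0_norm x : x \in Zadjoin z ->
  proj 0 (x * x^*) = \sum_(a < q) `|proj a x| ^+ 2.
Proof.
move=> xZ.
have -> : x * x^* = (\sum_(a < q) proj a x) * (\sum_(b < q) proj b x)^*.
  by rewrite -(sum_proj xZ).
rewrite mulr_suml proj_sum; apply: eq_bigr => a _; rewrite rmorph_sum mulr_sumr proj_sum.
have conjz k : (z ^+ k)^* = z ^- k by rewrite rmorphXn /= (prim_root_conj zP) exprVn.
have E (b : 'I_q) : proj 0 (proj a x * (proj b x)^*) =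
    (z ^+ (p * a) * z ^- (p * b) == 1)%:R * (proj a x * (proj b x)^*).
  rewrite (proj_eigen _ (v := z ^+ (p * a) * z ^- (p * b))) ?muln0 //.
    by rewrite exprMn exprVn !prim_expr_mulp_q invr1 mulr1.
  rewrite -conjz; apply: eigenM; first exact: eigen_projP.
  by apply: eigen_conj; [apply: Zadjoin_proj | apply: eigen_projP].
have zu k : z ^+ k \is a GRing.unit by rewrite unitrX // (prim_root_unitr zP).
rewrite (bigD1 a) //= E divrr // eqxx mul1r -normCK big1 ?addr0 // => b ba.
rewrite E -(inj_eq (mulIr (zu (p * b)%N))) divrK // mul1r eq_prim_expr_mulp.
by rewrite !modn_small // eq_sym (negPf (ba : val b != val a)) mul0r.
Qed.

(** * Congruences modulo 2, and the count of nonzero components *)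

Lemma sqr_sum_mod2 (I : Type) (r : seq I) (F : I -> algC) :
    (forall i, F i \in Zadjoin z) ->
  exists2 w, w \in Zadjoin z &
    (\sum_(i <- r) F i) ^+ 2 = \sum_(i <- r) F i ^+ 2 + 2%:R * w.
Proof.
move=> FZ; elim: r => [|i r [w wZ IH]].
  by exists 0; rewrite ?rpred0 // !big_nil expr0n mulr0 addr0.
exists (w + F i * \sum_(j <- r) F j).
  by rewrite rpredD // rpredM // rpred_sum.
by rewrite !big_cons sqrrD IH; ring.
Qed.

Lemma dvdz2_mulB1 (c : int) : (2 %| c * (c - 1))%Z.
Proof.
have [k [->|->]] : exists k : int, c = k * 2 \/ c = k * 2 + 1.
- by exists (c %/ 2)%Z; lia.
- by rewrite -mulrA mulrCA dvdz_mulr.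
- by rewrite addrK mulrA dvdz_mull.
Qed.

(* Frobenius at 2: x^2 is congruent to [gal 2 x] modulo 2. *)
Lemma even_of_sqr_even d w : d \in Zadjoin z -> w \in Zadjoin z ->
  d ^+ 2 = 2%:R * w -> exists2 v, v \in Zadjoin z & d = 2%:R * v.
Proof.
move=> dZ wZ dE; have N_odd : odd N by rewrite oddX p_odd orbT.
have c2 : coprime 2 N by rewrite coprime2n.
have [v vZ vE] : exists2 v, v \in Zadjoin z & gal N 2 d = d ^+ 2 + 2%:R * v.
  move: d dZ {dE}; apply: Zadjoin_ind => [c|x c xZ [v vZ IH]].
    exists (- (c * (c - 1) %/ 2)%Z%:~R); first by rewrite rpredN rpred_int.
    have := dvdz2_mulB1 c.
    move=> /divzK/(congr1 (intr : int -> algC)); rewrite !rmorphM /= rmorphB /= => cE.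
    by rewrite rmorph_int mulrN mulrC cE; ring.
  exists (v * z ^+ 2 - x * z * c%:~R - (c * (c - 1) %/ 2)%Z%:~R).
    by rewrite !(rpredB, rpredM, rpredX, rpred_int) // mem_Zadjoin.
  have := dvdz2_mulB1 c.
  move=> /divzK/(congr1 (intr : int -> algC)); rewrite !rmorphM /= rmorphB /= => cE.
  rewrite rmorphD rmorphM /= rmorph_int IH galE //.
  transitivity ((x ^+ 2 + 2 * v) * z ^+ 2 + c%:~R * (c%:~R - 1) - c%:~R * (c%:~R - 1) + c%:~R); first by ring.
  by rewrite -{2}cE; ring.
(* [h] is the inverse of 2 modulo N, so [gal N h] undoes [gal N 2] and carries the divisibility by 2
   back to d. *)
pose h := (N.+1)./2.
have h2 : (h * 2)%N = N.+1.
  by rewrite muln2 /h -[RHS]odd_double_half /= N_odd add0n.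
have ch : coprime h N.
  have : coprime (h * 2) N by rewrite h2 coprimeSn.
  by rewrite coprimeMl => /andP[].
exists (gal N h (w + v)); first by rewrite (Zadjoin_gal zP) // rpredD.
rewrite -[2%:R in RHS](rmorph_nat (gal N h)) -rmorphM mulrDr -dE -vE.
apply: (Zadjoin_rmorph_eq (u := idfun) (v := gal N h \o gal N 2) _ dZ).
by rewrite /= (gal_prim zP) // rmorphXn /= (gal_prim zP) // -exprM h2 exprS zN mulr1.
Qed.

Lemma half_notin_Aint (x : algC) : x \in Aint -> 2%:R * x != 1.
Proof.
move=> xA; apply/eqP => x2.
have two0 : 2%:R != 0 :> algC by rewrite pnatr_eq0.
have xE : x = 2%:R^-1 by apply: (mulfI two0); rewrite x2 divff.
have /intrP[k kE] : x \is a Num.int.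
  by apply: Cint_rat_Aint => //; rewrite xE rpredV rpred_nat.
have /(@intr_inj algC) : (2 * k)%:~R = 1%:~R :> algC by rewrite rmorphM /= -kE.
by lia.
Qed.

(** The sum is rational, so all its conjugates equal c. Added up they give c phi(N), to which each
    nonzero component contributes at least phi(N). *)
Lemma sum_ugal_norm_count (n c : nat) (y : 'I_n -> algC) :
    (forall k, y k \in Zadjoin z) ->
    \sum_k \sum_(a < q) `|proj a (y k)| ^+ 2 = c%:R ->
  (#|[set ka : 'I_n * 'I_q | (proj ka.2 (y ka.1) != 0)%R]| <= c)%N.
Proof.
move=> yZ yc; set W := [set _ | _].
have phi_gt0 : (0 < totient N)%N by rewrite totient_gt0 ltnW.
have sumE (s : {unit 'Z_N}) : \sum_k \sum_(a < q) `|ugal s (proj a (y k))| ^+ 2 = c%:R.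
  rewrite -(rmorph_nat (ugal s)) -yc rmorph_sum; apply: eq_bigr => k _.
  rewrite rmorph_sum; apply: eq_bigr => a _; rewrite !normCK [RHS]rmorphM /=.
  by rewrite (ugal_conj N_gt1 zP) // Zadjoin_proj.
have : \sum_(ka in W) (totient N)%:R <= \sum_(s : {unit 'Z_N}) c%:R :> algC.
  under [leRHS]eq_bigr => s _ do rewrite -(sumE s) pair_bigA /=.
  rewrite exchange_big /= [leRHS](bigID (mem W)) /=.
  rewrite -[leLHS]addr0 lerD // ?ler_sum //=; last first.
    by rewrite sumr_ge0 // => ka _; rewrite sumr_ge0 // => s _; rewrite exprn_ge0.
  move=> ka; rewrite inE => ka0.
  by rewrite (sum_ugal_norm_ge N_gt1 zP) // Zadjoin_proj.
rewrite !sumr_const (card_unit_Zp N_gt1) -!mulrnA ler_nat.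
by rewrite [(c * _)%N]mulnC leq_pmul2l.
Qed.

(** * The contradiction for a Sidon set of exponents *)

Section NotSumOfSquares.
Context (n : nat) (e : 'I_n.+1 -> bool -> nat) (y : 'I_n -> algC).
Hypothesis e_inv : forall l, z ^+ e l true * z ^+ e l false = 1.
Hypothesis e_inj : forall l b l' b',
  e l b = e l' b' %[mod q] -> l = l' /\ b = b'.
Hypothesis e_sidon : forall l l' i b i' b', l != l' ->
  e i b + e i' b' = e l true + e l' true %[mod q] ->
  [/\ i = l, b, i' = l' & b'] \/ [/\ i = l', b, i' = l & b'].
Hypothesis yZ : forall k, y k \in Zadjoin z.
Hypothesis y_real : forall k, (y k)^* = y k.
Hypothesis y_sum : \sum_k y k ^+ 2 = \sum_l (z ^+ e l true + z ^+ e l false) ^+ 2.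

Let T := ('I_n.+1 * bool)%type.
Let ex (x : T) := e x.1 x.2.
Let cl (x : T) : 'I_q := Ordinal (ltn_pmod (ex x) q_gt0).

Let cl_inj : injective cl.
Proof.
by move=> [l b] [l' b'] /(congr1 val) /= /e_inj[/= -> ->].
Qed.

Let zZ k : z ^+ k \in Zadjoin z.
Proof. by rewrite rpredX // mem_Zadjoin. Qed.

Let sum_squares_expand :
  \sum_k y k ^+ 2 = \sum_(x : T) z ^+ (ex x + ex x) + (2 * n.+1)%:R * z ^+ 0.
Proof.
rewrite y_sum -(pair_bigA _ (fun l b => z ^+ (e l b + e l b))) /= expr0 mulr1.
have -> : (2 * n.+1)%:R = \sum_(l < n.+1) 2%:R :> algC.
  by rewrite sumr_const card_ord mulrnA.
rewrite -big_split /=; apply: eq_bigr => l _.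
by rewrite sqrrD e_inv big_bool /= !exprD -!expr2; ring.
Qed.

Let proj_sum_squares (d : nat) : (forall x, ex x + ex x <> d %[mod q]) ->
  proj d (\sum_k y k ^+ 2) = (0 == d %[mod q])%:R * (2 * n.+1)%:R.
Proof.
move=> dne; rewrite sum_squares_expand projD proj_sum big1 => [|x _].
  by rewrite add0r projZnat projX expr0 mulr1 mulrC.
by rewrite projX (introF eqP (dne x)) mul0r.
Qed.

Let e_inv_mod l b : e l b + e l (~~ b) = 0 %[mod q].
Proof.
apply/eqP; rewrite mod0n -/(dvdn _ _) (@dvdn_trans N) ?dvdn_exp2l //.
rewrite (prim_order_dvd zP) exprD; case: b => /=; first by rewrite e_inv.
by rewrite mulrC e_inv.
Qed.

(** Otherwise the degrees j and -j would coincide. *)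
Let e_double x : ex x + ex x <> 0 %[mod q].
Proof.
case: x => l b; rewrite /ex /= -(e_inv_mod l b) => /eqP.
by rewrite eqn_modDl => /eqP /e_inj[_]; case: b.
Qed.

Let W := [set ka : 'I_n * 'I_q | (proj ka.2 (y ka.1) != 0)%R].

(** As the y_k are real, the degree 0 part of the sum of their squares is the sum of all |proj a
    y_k|^2; the expansion of the E_l gives it the value 2(n+1). *)
Let W_card : (#|W| <= #|{: T}|)%N.
Proof.
rewrite card_prod card_ord card_bool mulnC.
apply: (sum_ugal_norm_count yZ).
under eq_bigr do rewrite -proj0_norm // y_real -expr2.
by rewrite -proj_sum (proj_sum_squares e_double) eqxx mul1r.
Qed.

(** The sum [Y] of the y_k and the sum [E] of the monomials have congruent squares modulo 2, so Y +
    E is even. If no y_k had degree [cl x], the component of Y + E there would be z^(ex x), a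
    unit. *)
Let W_cover x : exists k, (k, cl x) \in W.
Proof.
have [w1 w1Z E1] := sqr_sum_mod2 (index_enum 'I_n) yZ.
have [w2 w2Z E2] := sqr_sum_mod2 (index_enum T) (fun x => zZ (ex x)).
set Y := \sum_k y k in E1; set E := \sum_x z ^+ ex x in E2.
have YZ : Y \in Zadjoin z by rewrite rpred_sum.
have EZ : E \in Zadjoin z by rewrite rpred_sum.
have SZ : \sum_k y k ^+ 2 \in Zadjoin z.
  by rewrite rpred_sum // => k _; rewrite rpredX.
(* Half of (Y + E)^2: the squares of the monomials add up to the sum of the y_k^2 minus 2(n+1). *)
pose w := \sum_k y k ^+ 2 + w1 + w2 + Y * E - n.+1%:R.
have wZ : w \in Zadjoin z by rewrite rpredB ?rpred_nat // !rpredD // rpredM.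
have [|v vZ vE] := even_of_sqr_even (rpredD YZ EZ) wZ.
  rewrite /w sqrrD E1 E2.
  have -> : \sum_x (z ^+ ex x) ^+ 2 = \sum_k y k ^+ 2 - (2 * n.+1)%:R.
    rewrite sum_squares_expand expr0 mulr1 addrK.
    by apply: eq_bigr => a _; rewrite exprD -expr2.
  by rewrite natrM; ring.
apply: contrapT => /forallNP W0.
have : proj (cl x) (Y + E) = z ^+ ex x.
  rewrite projD !proj_sum big1 ?add0r => [|k _]; last first.
    by apply/eqP; have /negP := W0 k; rewrite inE negbK.
  rewrite (bigD1 x) //= projX modn_mod eqxx mul1r big1 ?addr0 // => x' x'x.
  rewrite projX modn_mod; case: eqP => [h|_]; last by rewrite mul0r.
  by case/eqP: x'x; apply: cl_inj; apply: val_inj.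
rewrite vE projZnat => /(congr1 (fun u => u * z ^- ex x)).
rewrite divrr ?unitrX ?(prim_root_unitr zP) // -mulrA => /eqP; apply/negP.
apply: half_notin_Aint; apply: (prim_root_Zadjoin_Aint zP).
rewrite rpredM ?Zadjoin_proj // -exprVn rpredX //.
exact: Zadjoin_inv zP.
Qed.

(** Pigeonhole: the degrees in [W] include the 2(n+1) values of [cl], while [W] has at most 2(n+1)
    elements. *)
Let W_image : snd @: W = cl @: [set: T] /\ {in W &, injective snd}.
Proof.
have sub : cl @: [set: T] \subset snd @: W.
  by apply/subsetP => _ /imsetP[x _ ->]; have [k kW] := W_cover x; apply/imsetP; exists (k, cl x).
have cT : #|cl @: [set: T]| = #|{: T}| by rewrite card_imset ?cardsT.
have le := leq_imset_card snd W; have le' := subset_leq_card sub.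
have cE : #|snd @: W| = #|W| by have := W_card; lia.
split; last by apply/imset_injP; rewrite cE.
by apply/esym/eqP; rewrite eqEcard sub cT cE W_card.
Qed.

Let W_supp k a : (k, a) \in W -> exists x, a = cl x.
Proof.
case: W_image => WE _ kaW.
have : a \in snd @: W by apply/imsetP; exists (k, a).
by rewrite WE => /imsetP[x _ ->]; exists x.
Qed.

Lemma not_sum_of_squares_of_sidon : False.
Proof.
have [W_eq W_inj] := W_image.
(* Each of the n+1 degrees j_l picks some y_k; with only n of these, two degrees share one. *)
have /fin_all_exists[kk kkW] : forall l, exists k, (k, cl (l, true)) \in W.
  by move=> l; apply: W_cover.
have /injectivePn[l [l' ll' kE]] : ~~ injectiveb kk.
  apply/negP => /injectiveP/leq_card; rewrite !card_ord; lia.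
pose a := cl (l, true); pose b := cl (l', true); pose d := (e l true + e l' true)%N.
have ab : a != b by apply: contraNneq ll' => /cl_inj[->].
(* The expanded right-hand side has only the degrees 0 and twice a signed exponent; the Sidon
   property keeps j_l + j_l' away from all of them. *)
have : proj d (\sum_k y k ^+ 2) = 0.
  rewrite proj_sum_squares => [|[i c] /= h].
    suff -> : (0 == d %[mod q]) = false by rewrite mul0r.
    apply/eqP => h; have := e_inv_mod l true; rewrite h => /(e_sidon ll').
    by case=> [[_ _ _]|[_ _ _]].
  case: (e_sidon ll' h) => [[-> _ h' _]|[-> _ h' _]]; by rewrite h' eqxx in ll'.
pose t k (ab : 'I_q * 'I_q) :=
  (ab.1 + ab.2 == d %[mod q])%:R * (proj ab.1 (y k) * proj ab.2 (y k)).
have -> : proj d (\sum_k y k ^+ 2) = \sum_k \sum_ab t k ab.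
  rewrite proj_sum; apply: eq_bigr => k _.
  by rewrite expr2 proj_mul // pair_bigA.
(* A nonzero term pairs two degrees from [W] summing to d, hence a and b by the Sidon property; as
   each degree occurs in one y_k only, k is [kk l]. *)
have t0 k u : (k != kk l) || (u \notin [:: (a, b); (b, a)]) -> t k u = 0.
  case: u => u v; apply: contraTeq; rewrite /t /= mulf_eq0 pnatr_eq0 eqb0 mulf_eq0.
  rewrite !negb_or negbK => /and3P[/eqP h uW vW].
  have {}uW : (k, u) \in W by rewrite inE.
  have {}vW : (k, v) \in W by rewrite inE.
  have [[i c] uE] := W_supp uW; have [[i' c'] vE] := W_supp vW.
  have {}h : e i c + e i' c' = e l true + e l' true %[mod q].
    by rewrite -modnDm -[RHS]h uE vE /=.
  have {}kE : u \in [:: a; b] -> k = kk l.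
    rewrite !inE => /orP[] /eqP uE'.
      by have [] := W_inj _ _ uW (kkW l) uE'.
    by rewrite kE; have [] := W_inj _ _ uW (kkW l') uE'.
  case: (e_sidon ll' h) => [] [iE cE iE' cE']; rewrite uE vE iE cE iE' cE' in kE *;
    by rewrite kE -/a -/b ?inE ?eqxx ?andbF ?orbT.
rewrite (bigD1 (kk l)) //= [X in _ + X]big1 => [|k kl]; last first.
  by rewrite big1 // => u _; rewrite t0 ?kl.
rewrite (bigD1 (a, b)) //= (bigD1 (b, a)) /=; last by rewrite xpair_eqE negb_and eq_sym ab.
rewrite big1 => [|u /andP[u1 u2]]; last first.
  by rewrite t0 // !inE negb_or u1 u2 orbT.
have modab : (a + b = d %[mod q])%N by rewrite modnDm.
(* The terms at (a, b) and (b, a) are equal, so twice a product of two nonzero components would be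
   0. *)
rewrite /t /= [(b + a)%N]addnC modab eqxx !addr0 !mul1r [X in _ + X]mulrC -mulr2n => /eqP.
rewrite mulrn_eq0 mulf_eq0 /=; have := kkW l; have := kkW l'; rewrite -kE !inE /=.
by move=> /negPf -> /negPf ->.
Qed.

End NotSumOfSquares.

End PrimePower.

(** * Sidon exponents built from powers of 2 *)

Section Tower.
Local Open Scope ring_scope.

(** Uniqueness of binary expansions: as c and d differ, the right-hand side has two digits 1, which
    rules out a = b. *)
Lemma pow2_sum_inj (a b c d : nat) : c != d ->
  (2 ^ a + 2 ^ b = 2 ^ c + 2 ^ d)%N -> (a = c /\ b = d) \/ (a = d /\ b = c).
Proof.
have lt_pow u v : (u < v)%N -> (2 * 2 ^ u <= 2 ^ v)%N by rewrite -expnS leq_exp2l.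
have pow_inj u v : (2 ^ u = 2 ^ v)%N -> u = v by move=> /eqP; rewrite eqn_exp2l // => /eqP.
have pow_gt0 u : (0 < 2 ^ u)%N by rewrite expn_gt0.
wlog ltcd : c d / (c < d)%N => [wl cd E|_].
  case: (ltngtP c d) => [lt|lt|cdE]; [exact: wl| |by rewrite cdE eqxx in cd].
  rewrite eq_sym in cd; rewrite [RHS]addnC in E; have := wl d c lt cd E; tauto.
wlog leab : a b / (a <= b)%N => [wl E|].
  case: (leqP a b) => [le|/ltnW le]; first exact: wl.
  by rewrite [LHS]addnC in E; have := wl _ _ le E; tauto.
case: (ltngtP b d) => [lt|lt|->] E.
- have le : (2 ^ a <= 2 ^ b)%N by rewrite leq_exp2l.
  have := lt_pow _ _ lt; have := pow_gt0 c; lia.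
- have := lt_pow _ _ lt; have := lt_pow _ _ ltcd; have := pow_gt0 a; have := pow_gt0 c; lia.
- by left; split=> //; apply: pow_inj; lia.
Qed.

Lemma eqn_mod_int (a b d : nat) :
  a = b %[mod d] -> exists k : int, a%:Z - b%:Z = k * d%:Z.
Proof.
move=> ab; exists ((a %/ d)%:Z - (b %/ d)%:Z).
by rewrite {1}(divn_eq a d) {1}(divn_eq b d) ab; lia.
Qed.

(* With z^N = 1, the exponent N - j stands for -j. The offset 2^(n+1) forces the signs: a signed sum of two of the exponents
   2^(n+1) + 2^l can only equal a sum of two of them if both signs are positive. *)
Definition exponent (n N : nat) (l : 'I_n.+1) (b : bool) : nat :=
  let j := (2 ^ n.+1 + 2 ^ l)%N in if b then j else (N - j)%N.

Section Exponent.
Context (n q k : nat) (q_large : (8 * 2 ^ n.+1 <= q)%N) (k_gt0 : (0 < k)%N).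
Local Notation e := (@exponent n (k * q)).

Let pow_bound (l : 'I_n.+1) : (0 < 2 ^ l)%N /\ (2 * 2 ^ l <= 2 ^ n.+1)%N.
Proof. by rewrite expn_gt0 -expnS leq_exp2l. Qed.

Let exponentE (l : 'I_n.+1) b :
  exists c : int, (e l b)%:Z = c * q%:Z + (-1) ^+ (~~ b) * (2 ^ n.+1 + 2 ^ l)%N%:Z.
Proof.
have [l0 l1] := pow_bound l; rewrite /exponent; case: b.
  by exists 0; rewrite mul0r add0r expr0 mul1r.
exists k%:Z; rewrite expr1 mulN1r subzn ?PoszM //; nia.
Qed.

(** Turns congruences modulo q into equalities. With B = 2^(n+1), each 2^(n+1) + 2^l is at most
    3B/2, so a signed sum of four stays within 6B < 8B <= q. *)
Let mul_small (c x : int) : c * q%:Z = x -> `|x| < q%:Z -> x = 0.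
Proof.
move=> <-; rewrite normrM; have [->|c0] := eqVneq c 0; first by rewrite mul0r.
nia.
Qed.

Lemma exponent_inj l b l' b' : e l b = e l' b' %[mod q] -> l = l' /\ b = b'.
Proof.
have [l0 l1] := pow_bound l; have [l0' l1'] := pow_bound l'.
move=> /eqn_mod_int[c]; have [d ->] := exponentE l b; have [d' ->] := exponentE l' b'.
have q_large' := q_large; set B := (2 ^ n.+1)%N in q_large' l1 l1' *; move=> H.
have H1 := @mul_small (c + d' - d)
  ((-1) ^+ (~~ b) * (B + 2 ^ l)%N%:Z - (-1) ^+ (~~ b') * (B + 2 ^ l')%N%:Z).
have {H H1} : (-1) ^+ (~~ b) * (B + 2 ^ l)%N%:Z - (-1) ^+ (~~ b') * (B + 2 ^ l')%N%:Z = 0.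
  by apply: H1; first lia; case: (b); case: (b'); rewrite /= ?expr0 ?expr1; lia.
have pow_inj : (2 ^ l = 2 ^ l')%N -> l = l'.
  by move=> /eqP; rewrite eqn_exp2l // => /eqP/val_inj.
by case: (b); case: (b'); rewrite /= ?expr0 ?expr1 => H; split=> //; try apply: pow_inj; lia.
Qed.

Lemma exponent_sidon l l' i b i' b' : l != l' ->
    e i b + e i' b' = e l true + e l' true %[mod q] ->
  [/\ i = l, b, i' = l' & b'] \/ [/\ i = l', b, i' = l & b'].
Proof.
have [l0 l1] := pow_bound l; have [l0' l1'] := pow_bound l'.
have [i0 i1] := pow_bound i; have [i0' i1'] := pow_bound i'.
move=> ll' /eqn_mod_int[c]; rewrite (PoszD (e i b)) (PoszD (e l true)).
have [d1 ->] := exponentE i b; have [d2 ->] := exponentE i' b'.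
have [d3 ->] := exponentE l true; have [d4 ->] := exponentE l' true.
have q_large' := q_large; set B := (2 ^ n.+1)%N in q_large' l1 l1' i1 i1' *; rewrite /= expr0 !mul1r; move=> H.
have H1 := @mul_small (c + d3 + d4 - d1 - d2)
  ((-1) ^+ (~~ b) * (B + 2 ^ i)%N%:Z + (-1) ^+ (~~ b') * (B + 2 ^ i')%N%:Z
   - (B + 2 ^ l)%N%:Z - (B + 2 ^ l')%N%:Z).
have {H H1} : (-1) ^+ (~~ b) * (B + 2 ^ i)%N%:Z + (-1) ^+ (~~ b') * (B + 2 ^ i')%N%:Z
   - (B + 2 ^ l)%N%:Z - (B + 2 ^ l')%N%:Z = 0.
  by apply: H1; first lia; case: (b); case: (b'); rewrite /= ?expr0 ?expr1; lia.
case: (b); case: (b'); rewrite /= ?expr0 ?expr1 => H; try lia.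
have : (2 ^ i + 2 ^ i' = 2 ^ l + 2 ^ l')%N by lia.
move=> /pow2_sum_inj -/(_ ll') [[iE iE']|[iE iE']]; [left|right]; split=> //; exact: val_inj.
Qed.

End Exponent.

(** * Passage from the infinite tower to a finite level *)

Lemma integralOver_Aint (x : algC) : integralOver (intr : int -> algC) x <-> x \in Aint.
Proof.
split=> [[f f_monic rx]|].
  apply: (root_monic_Aint rx); first by rewrite monic_map.
  by apply/polyOverP => i; rewrite coef_map intr_int.
rewrite unfold_in => /floorpP[f fE]; exists f.
  have := minCpoly_monic x; rewrite fE !monicE lead_coef_map_inj ?rmorph0 //.
    by move=> /eqP h; apply/eqP/(@intr_inj algC).
  exact: intr_inj.
by rewrite -fE root_minCpoly.
Qed.

(** Chebyshev recurrence, with two consecutive indices carried through the induction. *)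
Lemma Qadjoin_expD_inv (z : algC) (i : nat) :
  z != 0 -> z ^+ i + z ^- i \in Qadjoin (z + z^-1).
Proof.
move=> z0; have [S1 SB SM] := GRing.divring_closedBM (Qadjoin_divring (z + z^-1)).
have Sz := mem_Qadjoin (z + z^-1).
suff [] : z ^+ i + z ^- i \in Qadjoin (z + z^-1) /\
          z ^+ i.+1 + z ^- i.+1 \in Qadjoin (z + z^-1) by [].
elim: i => [|i [IH1 IH2]].
  rewrite expr0 expr1 invr1; split=> //.
  by rewrite -[1 in X in _ + X]opprK SB // -(sub0r 1) SB // -(subrr 1) SB.
split=> //; have -> : z ^+ i.+2 + z ^- i.+2 =
    (z + z^-1) * (z ^+ i.+1 + z ^- i.+1) - (z ^+ i + z ^- i).
  by rewrite !exprS; field; rewrite expf_neq0.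
by rewrite SB ?SM.
Qed.

(** The numbers fixed by conjugation form a subfield containing zeta + zeta^-1. *)
Lemma Kplus_real (N : nat) (x : algC) : (0 < N)%N -> x \in Kplus N -> x^* = x.
Proof.
move=> N0 /QadjoinP/(_ (fun x => x^* == x)) xS; apply/eqP/xS.
  split=> [|u v /eqP uE /eqP vE|u v /eqP uE /eqP vE]; rewrite unfold_in.
  - by rewrite rmorph1.
  - by rewrite rmorphB /= uE vE.
  - by rewrite fmorph_div /= uE vE.
rewrite unfold_in rmorphD fmorphV /= (prim_root_conj (zeta_prim N0)).
by rewrite invrK addrC.
Qed.

Lemma Kplus_sub_Qadjoin (N : nat) (w : algC) :
  N.-primitive_root w -> {subset Kplus N <= Qadjoin w}.
Proof.
move=> wP; have N0 := prim_order_gt0 wP; have zP := zeta_prim N0.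
have [S1 SB SV] := Qadjoin_divring w.
have [_ _ SM] := GRing.divring_closedBM (Qadjoin_divring w).
apply: Qadjoin_sub; have [i zE] := prim_rootP wP (prim_expr_order zP).
have zQ : zeta N \in Qadjoin w.
  rewrite zE; elim: (i : nat) => [|k IH]; first by rewrite expr0.
  by rewrite exprS SM ?mem_Qadjoin.
rewrite -[X in _ + X]opprK SB // -(sub0r (zeta N)^-1) SB ?(subrr 1) //.
  by rewrite -(subrr 1) SB.
by rewrite -div1r SV.
Qed.

(** Being coprime to p^(M+1) and to p^(m+1) are the same condition, so the exponent expressing z at
    the lower level also yields a primitive root at the higher one. *)
Lemma prim_root_lift (p M m : nat) (z : algC) : prime p -> (M <= m)%N ->
    (p ^ M.+1).-primitive_root z ->
  exists2 w, (p ^ m.+1).-primitive_root w & z = w ^+ (p ^ (m - M)).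
Proof.
move=> pP Mm zP; have p0 := prime_gt0 pP.
have [v vP] := @C_prim_root_exists (p ^ m.+1) ltac:(by rewrite expn_gt0 p0).
have vrP : (p ^ M.+1).-primitive_root (v ^+ (p ^ (m - M))).
  have := dvdn_prim_root vP (dvdn_exp2l p (Mm : (M.+1 <= m.+1)%N)).
  by rewrite -expnB // subSS.
have [i zE] := prim_rootP vrP (prim_expr_order zP).
exists (v ^+ i); last by rewrite zE -!exprM mulnC.
move: zP; rewrite zE prim_root_exp_coprime // => iM.
rewrite prim_root_exp_coprime //; move: iM.
by rewrite !coprime_pexpr.
Qed.

Lemma Kplus_pinf_common (p n : nat) (y : 'I_n -> algC) (M : nat) : prime p ->
    (forall k, y k \in Kplus_pinf p) ->
  exists2 m, (M <= m)%N & forall k, y k \in Kplus (p ^ m.+1).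
Proof.
move=> pP yK; have p0 := prime_gt0 pP.
have /fin_all_exists[f fK] : forall k, exists m, y k \in Kplus (p ^ m).
  by move=> k; apply/asboolP; exact: yK.
exists (maxn M (\max_k f k)); first exact: leq_maxl.
move=> k; apply: sub_Kplus (fK k); first by rewrite expn_gt0 p0.
rewrite dvdn_exp2l // ltnW // ltnS leq_max orbC.
by rewrite (leq_bigmax k).
Qed.

(** The sum of the squares of the n+1 numbers z^j + z^-j is not a sum of n squares. The y_k may live
    at a higher level than z, so everything is rewritten in terms of a primitive root w of that
    level. *)
Lemma sums_of_squares_neq (p n : nat) : prime p -> odd p ->
  sums_of_squares (O_Kplus_pinf p) n <> sums_of_squares (O_Kplus_pinf p) n.+1.
Proof.
move=> hp p_odd sumsE; have p_gt1 := prime_gt1 hp.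
(* The shift by 4 gives 8 * 2^(n+1) = 2^M <= p^M = q, the size that the exponents require. *)
pose M := (n + 4)%N; pose q := (p ^ M)%N; pose z := zeta (p * q).
have q_large : (8 * 2 ^ n.+1 <= q)%N.
  have -> : (8 * 2 ^ n.+1 = 2 ^ M)%N by rewrite /M addn4 !(expnS 2); lia.
  have M0 : (0 < M)%N by rewrite /M addn4.
  by rewrite /q (leq_exp2r _ _ M0).
have q_gt0 : (0 < q)%N by rewrite expn_gt0 ltnW.
have zP : (p ^ M.+1).-primitive_root z.
  by rewrite expnS; apply: zeta_prim; rewrite muln_gt0 q_gt0 ltnW.
have z0 := prim_root_neq0 zP.
pose E (l : 'I_n.+1) : algC :=
  z ^+ exponent (p * q) l true + z ^- exponent (p * q) l true.
have EO l : E l \in int_Kplus_pinf p.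
  apply/andP; split.
    by apply/asboolP; exists M.+1; rewrite expnS; apply: Qadjoin_expD_inv.
  apply/asboolP/integralOver_Aint.
  have zA := Aint_prim_root zP.
  have zVA : z^-1 \in Aint by rewrite (prim_root_inv zP); apply: rpredX.
  by apply: rpredD; [|rewrite -exprVn]; apply: rpredX.
have : sums_of_squares (O_Kplus_pinf p) n.+1 (\sum_l (MkO (EO l)) ^+ 2).
  by exists (fun l => MkO (EO l)).
rewrite -sumsE => -[y yE].
have yP k : O_val (y k) \in int_Kplus_pinf p by case: (y k).
have [|m Mm yK] := @Kplus_pinf_common p n (fun k => O_val (y k)) M hp.
  by move=> k; have /andP[] := yP k.
have [w wP zE] := prim_root_lift hp Mm zP.
pose r := (p ^ (m - M))%N.
have r0 : (0 < r)%N by rewrite expn_gt0 ltnW.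
have qE : (p ^ m = r * q)%N by rewrite -expnD subnK.
(* As z = w^r, exponents are multiplied by r; since p^m = r q, congruences modulo p^m between
   multiples of r reduce to congruences modulo q. *)
pose e (l : 'I_n.+1) b := (r * exponent (p * q) l b)%N.
have e_mod a b : r * a = r * b %[mod p ^ m] -> a = b %[mod q].
  by rewrite qE -!muln_modr => /eqP; rewrite eqn_pmul2l // => /eqP.
have wE (l : 'I_n.+1) b : w ^+ e l b = z ^+ exponent (p * q) l b by rewrite exprM zE.
have exp_inv (l : 'I_n.+1) :
    z ^+ exponent (p * q) l true * z ^+ exponent (p * q) l false = 1.
  have jq : (2 ^ n.+1 + 2 ^ l <= q)%N.
    have : (2 ^ l <= 2 ^ n.+1)%N by rewrite leq_exp2l // ltnW.
    by move: q_large; lia.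
  rewrite -exprD /exponent subnKC; first by rewrite -expnS (prim_expr_order zP).
  exact: leq_trans jq (leq_pmull q (ltnW p_gt1)).
apply: (@not_sum_of_squares_of_sidon p m hp p_odd w wP n e (fun k => O_val (y k))).
- by move=> l; rewrite !wE.
- move=> l b l' b' /e_mod; apply: exponent_inj => //; exact: ltnW.
- move=> l l' i b i' b' ll'; rewrite -!mulnDr => /e_mod.
  by apply: exponent_sidon => //; apply: ltnW.
- move=> k; apply: (Aint_Qadjoin_Zadjoin hp p_odd wP).
    exact: (Kplus_sub_Qadjoin wP).
  by have /andP[_ /asboolP/integralOver_Aint] := yP k.
- by move=> k; apply: Kplus_real (yK k); rewrite expn_gt0 ltnW.
transitivity (\sum_k val (y k ^+ 2)).
  by apply: eq_bigr => k _; rewrite rmorphXn.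
rewrite -rmorph_sum -yE rmorph_sum; apply: eq_bigr => l _; rewrite rmorphXn.
congr (_ ^+ 2); rewrite !wE; congr (_ + _).
by rewrite -[LHS]mulr1 -(exp_inv l) mulKf // expf_neq0.
Qed.

End Tower.

Theorem theorem1p2 (p : nat) (hp : prime p) (hp4 : p = 1 %[mod 4]) :
  Pythagoras_number (O_Kplus_pinf p) = None.
Proof.
have p_odd : odd p by lia.
rewrite /Pythagoras_number; case: pselect => // exn; exfalso.
by case: exn => n /asboolP; apply: sums_of_squares_neq.
Qed.
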